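(* For a random variable $X$ we have \[J_\alpha(X)=\int_0^1V(Q_X(p),p)\,dp,\] where \[V(x,p):=(1-\alpha)u\big(x+Q_\vartheta(p)\big)+\alpha u\big(x+Q_\vartheta(1-p)\big),\quad x\in\mathbb R,\ p\in(0,1).\] Also, the functional $J_\alpha$ is law-invariant in the sense that $J_\alpha(X)=J_\alpha(Y)$ if $X\sim Y$, and strictly increasing in the sense that $J_\alpha(X_1)>J_\alpha(X_2)$ if $X_1\ge X_2$ and $\mathbb P(X_1>X_2)>0$. In particular, $J_\alpha(X+\varepsilon)>J_\alpha(X)$ for any constant $\varepsilon>0$.
   Context: $(\Omega,\mathbb F,\mathbb P)$ is a complete probability space carrying a standard $m$-dimensional Brownian motion (in particular it is atomless); ''random variable'' means $\mathbb F$-measurable, and $X\sim Y$ means equality in distribution. The quantile of a random variable $Y$ with distribution function $F_Y$ is $Q_Y(p)=\inf\{z\in\mathbb R:F_Y(z)>p\}$, $p\in(0,1)$, extended by limits to $p=0,1$. $u(x)=-\int_0^\infty e^{-\gamma x}\,dF(\gamma)$, $x\in\mathbb R$, where $F$ is a non-zero distribution function ($dF$ is a non-zero finite Borel measure, not necessarily of mass one) supported on a compact subset of $(0,\infty)$. $\vartheta$ is a random variable (the intractable claim) whose quantile $Q_\vartheta$ is Lipschitz continuous and differentiable on $[0,1]$ (so $\vartheta$ is bounded). $\alpha\in[0,1]$ is fixed and \[J_\alpha(X)=(1-\alpha)\inf_{Y\sim\vartheta}\mathbb E[u(X+Y)]+\alpha\sup_{Y\sim\vartheta}\mathbb E[u(X+Y)],\]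 where inf and sup run over all random variables $Y$ on $(\Omega,\mathbb F,\mathbb P)$ with the same distribution as $\vartheta$.
   Formalization: Since J_α may equal −∞ for an unbounded X (then J_α(X+ε)=J_α(X)=−∞), strict increase is claimed only when J_α(X_1)>−∞, and J_α(X+ε)>J_α(X) only when J_α(X)>−∞; the formula and law-invariance hold for all X. *)

(* Defs.v *)
From HB Require Import structures.
From mathcomp Require Export all_boot all_order all_algebra.
From mathcomp Require Export all_classical all_reals all_analysis.

Set Implicit Arguments.
Unset Strict Implicit.
Unset Printing Implicit Defensive.

Import Order.TTheory GRing.Theory Num.Theory.
Import numFieldTopology.Exports numFieldNormedType.Exports.

Local Open Scope classical_set_scope.
Local Open Scope ring_scope.

Section random_variables.
Context (R : realType) (d : measure_display) (T : measurableType d).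
Variable P : probability T R.

(* Only measurable sets are compared: [distribution P X] is total on [set R],
   and nothing is known of P on non-measurable preimages. *)
Definition same_law (X Y : {RV P >-> R}) : Prop :=
  forall A : set R, measurable A -> distribution P X A = distribution P Y A.

(* The product rule for the whole family gives it for every subfamily, since
   A i = setT is allowed. *)
Definition mutually_independent (I : finType) (X : I -> T -> R) : Prop :=
  forall A : I -> set R, (forall i, measurable (A i)) ->
    P (\bigcap_(i in [set: I]) (X i @^-1` A i)) =
    (\prod_(i : I) P (X i @^-1` A i))%E.

(* W t i is the i-th coordinate at time t; only times t >= 0 matter. Joint
   independence over (coordinate, time step) expresses both the independence of
   the vector increments and that of the coordinates. The second argument of
   normal_prob is the standard deviation. *)
Definition standard_brownian_motion (m : nat)
    (W : R -> 'I_m -> {RV P >-> R}) : Prop :=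
  [/\ {ae P, forall w, forall i, W 0 i w = 0},
      forall (i : 'I_m) (s t : R), 0 <= s -> s < t ->
        forall A : set R, measurable A ->
          P ((W t i \- W s i) @^-1` A) = normal_prob 0 (Num.sqrt (t - s)) A,
      forall (n : nat) (t : nat -> R), 0 <= t 0%N ->
        (forall k, (k < n)%N -> t k < t k.+1) ->
        mutually_independent (fun ik : 'I_m * 'I_n =>
          W (t ik.2.+1) ik.1 \- W (t ik.2) ik.1) &
      {ae P, forall w, forall i,
        {within `[0, +oo[, continuous (fun t => W t i w)}}].

Definition quantile_oo (Y : {RV P >-> R}) (p : R) : R :=
  inf [set z : R | (p%:E < cdf Y z)%E].

(* The limits are meaningful only when they exist in R; a function that is
   Lipschitz on [0, 1] is Lipschitz on ]0, 1[, which makes them exist. *)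
Definition quantile (Y : {RV P >-> R}) (p : R) : R :=
  if p <= 0 then lim (quantile_oo Y q @[q --> 0^'+])
  else if 1 <= p then lim (quantile_oo Y q @[q --> 1^'-])
  else quantile_oo Y p.

End random_variables.

(* One-sided at those points of D that are endpoints of D. *)
Definition differentiable_in (R : realType) (D : set R) (f : R -> R) : Prop :=
  forall p, D p -> cvg ((f q - f p) / (q - p) @[q --> within D p^']).

Section utility.
Context (R : realType) (c : R) (F : cumulativeBounded (0 : R) c).

Definition compactly_supported_in_pos : Prop :=
  exists K : set R, [/\ compact K, K `<=` `]0, +oo[ &
    lebesgue_stieltjes_measure F (~` K) = 0%E].

Definition utility (x : R) : R :=
  - (\int[lebesgue_stieltjes_measure F]_(g in `]0, +oo[) expR (- (g * x)))%R.

End utility.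

Section objective.
Context (R : realType) (d : measure_display) (T : measurableType d).
Variables (P : probability T R) (u : R -> R).
Variables (theta : {RV P >-> R}) (alpha : R).

Local Open Scope ereal_scope.

Definition expected_utilities (X : T -> R) : set (\bar R) :=
  [set 'E_P[fun w => u (X w + Y w)%R] | Y in [set Y | same_law Y theta]].

(* Extended-real valued: -oo is possible, as X need not be bounded below. *)
Definition objective (X : T -> R) : \bar R :=
  (1 - alpha)%:E * ereal_inf (expected_utilities X) +
  alpha%:E * ereal_sup (expected_utilities X).

Definition quantile_utility (x p : R) : R :=
  ((1 - alpha) * u (x + quantile theta p) +
   alpha * u (x + quantile theta (1 - p)))%R.

End objective.

(* Main.v *)
From HB Require Import structures.
Require Import Defs.
From mathcomp Require Import measurable_realfun.

Set Implicit Arguments.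
Unset Strict Implicit.
Unset Printing Implicit Defensive.

Import Order.TTheory GRing.Theory Num.Theory.
Import numFieldTopology.Exports numFieldNormedType.Exports.

Local Open Scope classical_set_scope.
Local Open Scope ring_scope.

(* Since [-u (x + y)] is the integral of [e^(-gx) e^(-gy)] against [dF(g)] and,
   by the layer-cake formula, [E[AB]] is the integral of [P (s < A, t < B)] for
   nonnegative [A] and [B], the expected disutility [E[-u (X + Y)]] is monotone
   in the joint distribution function [P (X < s, Y < t)]. When [Y ~ theta] that
   function lies between the two Frechet bounds, which are the joint
   distribution functions of [(Q_X, Q_theta (1 - .))] and [(Q_X, Q_theta)] under
   the Lebesgue measure on [0, 1]. Both bounds are attained by a function of a
   uniform variable [U] comonotone with [X]. Such a [U] exists without any
   independent randomization: an increment [Z] of the Brownian motion has an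
   atomless law, and [U] is the rank of [(X, Z)] in the lexicographic order.
   Strict monotonicity then follows from that of [u], the infimum and the
   supremum being attained. *)

(** * Strict comparison of integrals; utilities that are mixtures of exponentials *)

Lemma lt_integral (d : measure_display) (T : measurableType d) (R : realType)
    (mu : {measure set T -> \bar R}) (D : set T) (mD : measurable D)
    (f g : T -> R) :
  measurable_fun D f -> measurable_fun D g ->
  (forall x, D x -> 0 <= f x) -> (forall x, D x -> 0 <= g x) ->
  (\int[mu]_(x in D) (f x)%:E < +oo)%E ->
  {ae mu, forall x, D x -> f x <= g x} ->
  (0 < mu (D `&` [set x | (f x < g x)%R]))%E ->
  (\int[mu]_(x in D) (f x)%:E < \int[mu]_(x in D) (g x)%:E)%E.
Proof.
move=> mf mg f0 g0 foo fg fltg.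
(* The positive part of [g - f]: nonnegative everywhere, equal to [g - f] almost everywhere on [D],
   and positive on a subset of positive measure, so its integral cannot vanish. *)
pose h x := Num.max (g x - f x) 0.
have mh : measurable_fun D h.
  by apply: measurable_maxr => //; exact: measurable_funB.
have h0 x : 0 <= h x by rewrite /h le_max lexx orbT.
have hpos : (0 < \int[mu]_(x in D) (h x)%:E)%E.
  rewrite lt_neqAle integral_ge0 ?andbT; last by move=> x _; rewrite lee_fin.
  apply/negP => /eqP/esym inth0.
  have : ae_eq mu D (EFin \o h) (cst 0%E).
    apply/ae_eq_integral_abs => //; first exact/measurable_EFinP.
    rewrite -[RHS]inth0; apply: eq_integral => x _ /=.
    by rewrite ger0_norm.
  move=> [N [mN N0 hN]].
  move: fltg; apply/negP; rewrite -leNgt -N0 le_measure ?inE//.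
    exact: measurable_fun_ltr.
  move=> x [Dx fgx]; apply: hN => /= /(_ Dx) [] /eqP; apply/negP.
  by rewrite gt_eqF// /h lt_max subr_gt0 fgx.
(* Since the integral of [f] is finite, adding the positive integral of [h] increases it strictly;
   the integral of [g] may be infinite. *)
apply: (@lt_le_trans _ _ (\int[mu]_(x in D) ((f x)%:E + (h x)%:E))%E).
  rewrite ge0_integralD//=; last 3 first.
  - exact/measurable_EFinP.
  - by move=> x _; rewrite lee_fin.
  - exact/measurable_EFinP.
  rewrite lteDl// ge0_fin_numE//.
  by apply: integral_ge0 => x Dx; rewrite lee_fin f0.
apply: ae_ge0_le_integral => //.
- by move=> x Dx; apply: adde_ge0; rewrite lee_fin ?f0.
- by apply: emeasurable_funD; exact/measurable_EFinP.
- exact/measurable_EFinP.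
apply: filterS fg => x fgx Dx; rewrite -EFinD lee_fin /h.
by rewrite max_l ?subr_ge0 ?fgx// addrC subrK.
Qed.

Section utility_theory.
Context (R : realType) (c : R) (F : cumulativeBounded (0 : R) c).
Hypothesis F_supp : compactly_supported_in_pos F.

Local Notation mu := (lebesgue_stieltjes_measure F).

Lemma lebesgue_stieltjes_measure_itvoc (a b : R) : a <= b ->
  mu `]a, b]%classic = (F b - F a)%:E.
Proof.
move=> ab; rewrite /lebesgue_stieltjes_measure /measure_extension/=.
by rewrite measurable_mu_extE/= ?wlength_itv_bnd//; exact: is_ocitv.
Qed.

Lemma bounded_lebesgue_stieltjes_lty (K : set R) (M : R) :
  K `<=` `]- M, M]%classic -> measurable K -> (mu K < +oo)%E.
Proof.
move=> KM mK; have [M0|M0] := leP 0 M; last first.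
  suff -> : K = set0 by rewrite measure0 ltry.
  rewrite -subset0 => x /KM /=.
  rewrite in_itv/= => /andP[a b]; have := lt_trans (lt_le_trans a b) M0.
  by rewrite oppr_lt0 ltNge ltW.
apply: (@le_lt_trans _ _ (mu `]- M, M]%classic)).
  by apply: le_measure; rewrite ?inE.
by rewrite lebesgue_stieltjes_measure_itvoc ?ltry// ge0_cp.
Qed.

(** All the mass sits on a compact [K]; there the exponent is bounded and the total mass is
    finite. *)
Lemma exp_integral_lty (x : R) :
  (\int[mu]_(g in `]0%R, +oo[) (expR (- (g * x)))%:E < +oo)%E.
Proof.
have [K [cK K0 muK]] := F_supp.
have mK : measurable K by exact: compact_measurable.
have me D : measurable_fun D (fun g : R => (expR (- (g * x)))%:E).
  apply/measurable_EFinP/measurable_funTS/measurableT_comp => //.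
  by apply: measurable_funN; exact: mulrr_measurable.
have [M [Mreal KM]] := compact_bounded cK.
have {}KM y : K y -> `|y| <= M + 1 by apply: KM; rewrite ltrDl.
have muKoo : (mu K < +oo)%E.
  (* [M + 2] instead of [M + 1], because the half-open interval excludes its left end. *)
  apply: (@bounded_lebesgue_stieltjes_lty _ (M + 2)) => // y Ky.
  have := KM _ Ky; rewrite ler_norml => /andP[a b].
  rewrite /= in_itv/= (lt_le_trans _ a)/= ?(le_trans b)//.
    by rewrite lerD2l ler1n.
  by rewrite ltrN2 ltrD2l ltr1n.
rewrite (ge0_negligible_integral _ _ _ _ muK)//;
  [|exact: measurableC|exact: me].
apply: (@le_lt_trans _ _
    (\int[mu]_(g in `]0%R, +oo[ `\` ~` K) (expR ((M + 1) * `|x|))%:E)%E).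
  have mDK : measurable (`]0, +oo[ `\` ~` K : set R).
    by apply: measurableD => //; exact: measurableC.
  apply: ge0_le_integral => //; first exact: me.
  move=> g [_ /contrapT Kg]; rewrite lee_fin ler_expR.
  rewrite (le_trans (ler_norm _))// normrN normrM ler_wpM2r//.
  exact: KM.
rewrite setDE setCK setIC setIidl// integral_cst//.
by rewrite lte_mul_pinfty// lee_fin expR_ge0.
Qed.

(** Finiteness of the integral is what makes the real-valued [utility] agree with the extended
    nonnegative integral, to which Tonelli and monotonicity apply. *)
Lemma exp_integralE (x : R) :
  (\int[mu]_(g in `]0%R, +oo[) (expR (- (g * x)))%:E = (- utility F x)%:E)%E.
Proof.
rewrite /utility opprK /Rintegral fineK// ge0_fin_numE ?exp_integral_lty//.
by apply: integral_ge0 => g _; rewrite lee_fin expR_ge0.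
Qed.

Lemma utility_le0 (x : R) : utility F x <= 0.
Proof.
rewrite -oppr_ge0 -lee_fin -exp_integralE.
by apply: integral_ge0 => g _; rewrite lee_fin expR_ge0.
Qed.

Hypothesis F_neq0 : exists x, F x != 0.

(** As [F] tends to 0 at minus infinity, a point [a] with [F a != 0] has some [y <= a] with
    [F y < F a], so []y, a]] has positive mass; this mass lies in []0, +oo[] up to the null
    complement of [K]. *)
Lemma lebesgue_stieltjes_pos_gt0 : (0 < mu `]0%R, +oo[%classic)%E.
Proof.
have [K [cK K0 muK]] := F_supp.
have mK : measurable K by exact: compact_measurable.
have [a Fa] := F_neq0.
have [y [ya Fya]] : exists y, y <= a /\ `|F y| < `|F a|.
  have /cvgr0_norm_lt/(_ `|F a|) := @cumulativeNy _ _ _ F.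
  rewrite normr_gt0 => /(_ Fa) [M [_ FM]].
  (* The estimate on [F] holds strictly below [M], hence at [M - 1]; the minimum also keeps the
     point at most [a]. *)
  exists (Num.min a (M - 1)); rewrite ge_min lexx; split => //.
  by apply: FM; rewrite gt_min ltrBlDr ltrDl ltr01 orbT.
have Fay : F y < F a.
  rewrite lt_neqAle (cumulative_is_nondecreasing F)// andbT.
  by apply: contraTneq Fya => ->; rewrite ltxx.
have : (0 < mu `]y, a]%classic)%E.
  by rewrite lebesgue_stieltjes_measure_itvoc// lte_fin subr_gt0.
rewrite !lt_neqAle => /andP[+ _]; rewrite measure_ge0 andbT.
apply: contra_neq => /esym mu0; apply/esym/eqP; rewrite eq_le measure_ge0 andbT.
apply: (@le_trans _ _ (mu (`]0%R, +oo[%classic `|` ~` K))).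
  apply: le_measure; rewrite ?inE//.
    by apply: measurableU => //; exact: measurableC.
  move=> x _; have [Kx|] := pselect (K x); [left|by right].
  exact: K0.
rewrite (le_trans (measureU2 _ _ _))//; first exact: measurableC.
by rewrite [X in (X + _)%E]mu0 [X in (_ + X)%E]muK adde0.
Qed.

Lemma utility_increasing : {homo utility F : x y / x < y}.
Proof.
move=> x y xy; rewrite -ltrN2 -lte_fin -!exp_integralE.
have me z D : measurable_fun D (fun g : R => expR (- (g * z))).
  apply/measurable_funTS/measurableT_comp => //.
  by apply: measurable_funN; exact: mulrr_measurable.
apply: lt_integral.
- by [].
- exact: me.
- exact: me.
- by move=> g _; exact: expR_ge0.
- by move=> g _; exact: expR_ge0.
- exact: exp_integral_lty.
- apply: aeW => g /=; rewrite in_itv/= andbT => g0.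
  by rewrite ler_expR lerN2 ler_pM2l// ltW.
rewrite setIidl; first exact: lebesgue_stieltjes_pos_gt0.
move=> g /=; rewrite in_itv/= andbT => g0.
by rewrite ltr_expR ltrN2 ltr_pM2l.
Qed.

Lemma utility_nondecreasing : {homo utility F : x y / x <= y}.
Proof. by apply: ltW_homo => x y /utility_increasing. Qed.

Lemma measurable_utility : measurable_fun setT (utility F).
Proof.
by apply: nondecreasing_measurable => // x y; exact: utility_nondecreasing.
Qed.

End utility_theory.

(** * Tonelli on rectangles and the layer-cake formula for a product *)

Lemma lebesgue_measure_itv0 (R : realType) (a : R) : 0 <= a ->
  lebesgue_measure `]0, a[%classic = a%:E.
Proof.
rewrite lebesgue_measure_itv/= lte_fin le_eqVlt.
by move=> /orP[/eqP<-|->]; rewrite ?ltxx ?sube0.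
Qed.

Section tonelli_domains.
Local Open Scope ereal_scope.
Context (d1 d2 : measure_display) (T1 : measurableType d1)
  (T2 : measurableType d2) (R : realType).
Variables (m1 : {sigma_finite_measure set T1 -> \bar R})
  (m2 : {sigma_finite_measure set T2 -> \bar R}).
Variables (D : set T1) (E : set T2) (f : T1 * T2 -> \bar R).
Hypotheses (mD : measurable D) (mE : measurable E).
Hypotheses (mf : measurable_fun setT f) (f0 : forall q, 0 <= f q).

Let h := f \_ (D `*` E).

Let h0 q : 0 <= h q.
Proof. by rewrite /h patchE; case: ifP. Qed.

Let mh : measurable_fun setT h.
Proof.
apply/(measurable_restrictT _ _).1; first exact: measurableX.
exact: measurable_funTS.
Qed.

Let integral_left x :
  \int[m2]_y h (x, y) = ((fun x => \int[m2]_(y in E) f (x, y)) \_ D) x.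
Proof.
rewrite patchE; case: ifPn => [|] xD.
  rewrite [RHS]integral_mkcond; apply: eq_integral => y _.
  by rewrite /h !patchE in_setX/= xD.
apply: integral0_eq => y _.
by rewrite /h patchE in_setX/= (negbTE xD).
Qed.

Let integral_right y :
  \int[m1]_x h (x, y) = ((fun y => \int[m1]_(x in D) f (x, y)) \_ E) y.
Proof.
rewrite patchE; case: ifPn => [|] yE.
  rewrite [RHS]integral_mkcond; apply: eq_integral => x _.
  by rewrite /h !patchE in_setX/= yE andbT.
apply: integral0_eq => x _.
by rewrite /h patchE in_setX/= (negbTE yE) andbF.
Qed.

(** Reduced to Tonelli on the whole product by extending [f] by zero outside [D] times [E]. *)
Lemma ge0_fubini_in : \int[m1]_(x in D) \int[m2]_(y in E) f (x, y) =
  \int[m2]_(y in E) \int[m1]_(x in D) f (x, y).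
Proof.
rewrite integral_mkcond [RHS]integral_mkcond.
under eq_integral do rewrite -integral_left.
under [RHS]eq_integral do rewrite -integral_right.
exact: fubini_tonelli.
Qed.

Lemma measurable_ge0_fubini_in :
  measurable_fun E (fun y => \int[m1]_(x in D) f (x, y)).
Proof.
apply/(measurable_restrictT _ _).2 => //.
rewrite (_ : _ \_ _ = fun y => \int[m1]_x h (x, y)).
  exact: measurable_fun_fubini_tonelli_G.
by apply/funext => y; rewrite integral_right.
Qed.

End tonelli_domains.

Section plane_measure.
Context (R : realType).

(* A named constant, because no sigma-finite structure is inferred on the bare
   product of two copies of [lebesgue_measure]. *)
Definition plane_measure :
    set (measurableTypeR R * measurableTypeR R) -> \bar R :=
  (lebesgue_measure \x lebesgue_measure)%E.

HB.instance Definition _ := Measure.on plane_measure.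

Let plane_measure_sigma_finite : sigma_finite setT plane_measure.
Proof.
exists (fun n : nat => (`]- n%:R, n%:R[ `*` `]- n%:R, n%:R[)%classic).
  apply/esym; rewrite -subTset => -[x y] _.
  exists (Num.truncn (`|x| + `|y|)).+1 => //=.
  have := truncnS_gt (`|x| + `|y|); rewrite !in_itv/= -!ltr_norml => h.
  by split; rewrite (le_lt_trans _ h)// ?lerDl ?lerDr.
move=> n; split; first exact: measurableX.
have leb_lty :
    (lebesgue_measure `](- n%:R)%R, n%:R%R[%classic < +oo :> \bar R)%E.
  by rewrite lebesgue_measure_itv/=; case: ifPn; rewrite ?ltry.
by rewrite /plane_measure product_measure1E// lte_mul_pinfty// ge0_fin_numE.
Qed.

HB.instance Definition _ := Measure_isSigmaFinite.Build _ _ _ plane_measure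
  plane_measure_sigma_finite.

End plane_measure.

Arguments plane_measure : clear implicits.

Section layer_cake.
Local Open Scope ereal_scope.
Context (d : measure_display) (T : measurableType d) (R : realType).
Variable mu : {sigma_finite_measure set T -> \bar R}.
Variables (D : set T) (A B : T -> R).
Hypotheses (mD : measurable D) (mA : measurable_fun setT A)
  (mB : measurable_fun setT B).
Hypotheses (A0 : forall w, (0 <= A w)%R) (B0 : forall w, (0 <= B w)%R).

(** Empty unless both coordinates of [z] are positive, so that the layers can be integrated over the
    whole plane. *)
Definition layer (z : R * R) : set T :=
  D `&` [set w | (0 < z.1 < A w)%R /\ (0 < z.2 < B w)%R].

Let S : set (T * (R * R)) := [set q | layer q.2 q.1].

Let mS : measurable S.
Proof.
have -> : S = (fst @^-1` D) `&` ([set q | (0 < q.2.1)%R] `&`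
    [set q | (q.2.1 < A q.1)%R] `&` ([set q | (0 < q.2.2)%R] `&`
    [set q | (q.2.2 < B q.1)%R])).
  apply/seteqP; split=> -[w [s t]]; rewrite /S /layer /=.
    by move=> [Dw [/andP[? ?] /andP[? ?]]].
  by move=> [Dw [[-> ->] [-> ->]]].
have lt_set (f g : T * (R * R) -> R) : measurable_fun setT f ->
    measurable_fun setT g -> measurable [set q | (f q < g q)%R].
  move=> mf mg; rewrite -[X in measurable X]setTI.
  exact: measurable_fun_ltr.
have m1 : measurable_fun setT (fun q : T * (R * R) => q.2.1).
  by apply: measurableT_comp => //; exact: measurable_fst.
have m2 : measurable_fun setT (fun q : T * (R * R) => q.2.2).
  by apply: measurableT_comp => //; exact: measurable_snd.
apply: measurableI.
  by rewrite -[X in measurable X]setTI; exact: measurable_fst.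
apply: measurableI; apply: measurableI; apply: lt_set => //.
- by apply: measurableT_comp => //.
- by apply: measurableT_comp => //.
Qed.

Let ysectionS z : ysection S z = layer z.
Proof. by apply/seteqP; split=> w; rewrite /ysection/= inE. Qed.

Lemma measurable_measure_layer :
  measurable_fun setT (fun z => mu (layer z)).
Proof.
rewrite (_ : (fun z => _) = mu \o ysection S).
  exact: measurable_fun_ysection.
by apply/funext => z /=; rewrite ysectionS.
Qed.

(** [A w * B w] is the area of the rectangle []0, A w[] times []0, B w[], which is the section of
    [S] at [w]; the sections in the other direction are the layers, and Tonelli equates the two
    integrals. *)
Lemma integral_mul_layer : \int[mu]_(w in D) (A w * B w)%:E =
  \int[plane_measure R]_z mu (layer z).
Proof.
have := indic_fubini_tonelli mu (plane_measure R) mS.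
rewrite indic_fubini_tonelli_FE// indic_fubini_tonelli_GE// => intS.
transitivity (\int[mu]_w (plane_measure R \o xsection S) w); last first.
  by rewrite intS; apply: eq_integral => z _ /=; rewrite ysectionS.
rewrite integral_mkcond; apply: eq_integral => w _ /=.
rewrite patchE; case: ifPn => [|] wD; last first.
  rewrite (_ : xsection _ _ = set0) ?measure0//.
  rewrite -subset0 => z; rewrite /xsection/= inE/= => -[/mem_set].
  by rewrite (negbTE wD).
rewrite (_ : xsection _ _ = `]0%R, A w[%classic `*` `]0%R, B w[%classic).
  rewrite /plane_measure product_measure1E// EFinM.
  by congr (_ * _); apply/esym; exact: lebesgue_measure_itv0.
apply/seteqP; split=> -[s t]; rewrite /xsection /S /layer/= ?inE/=.
  by case.
by move: wD; rewrite inE.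
Qed.

End layer_cake.

(** * Comparison of disutilities through joint distribution functions *)

Section exp_comparison.
Local Open Scope ereal_scope.
Context (R : realType) (d1 d2 : measure_display).
Context (T1 : measurableType d1) (T2 : measurableType d2).
Variables (m1 : {sigma_finite_measure set T1 -> \bar R})
  (m2 : {sigma_finite_measure set T2 -> \bar R}).
Variables (D1 : set T1) (D2 : set T2).
Hypotheses (mD1 : measurable D1) (mD2 : measurable D2).
Variables (X1 Y1 : T1 -> R) (X2 Y2 : T2 -> R).
Hypotheses (mX1 : measurable_fun setT X1) (mY1 : measurable_fun setT Y1).
Hypotheses (mX2 : measurable_fun setT X2) (mY2 : measurable_fun setT Y2).
Hypothesis le_joint : forall s t : R,
  m1 (D1 `&` [set w | (X1 w < s)%R /\ (Y1 w < t)%R]) <=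
  m2 (D2 `&` [set w | (X2 w < s)%R /\ (Y2 w < t)%R]).

Let measurable_expN (d : measure_display) (T : measurableType d) (g : R)
  (X : T -> R) : measurable_fun setT X ->
  measurable_fun setT (fun w => expR (- (g * X w))%R).
Proof.
move=> mX; apply: measurableT_comp => //.
apply: measurable_funN; apply: measurable_funM => //.
Qed.

(** Taking logarithms turns each superlevel set of a decreasing exponential into a lower ray, so the
    layers are exactly the events that [le_joint] compares. *)
Let layer_exp (T : Type) (D : set T) (X Y : T -> R) (g s t : R) :
  (0 < g)%R -> (0 < s)%R -> (0 < t)%R ->
  D `&` [set w | (0 < s < expR (- (g * X w)))%R /\
                 (0 < t < expR (- (g * Y w)))%R] =
  D `&` [set w | (X w < - ln s / g)%R /\ (Y w < - ln t / g)%R].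
Proof.
move=> g0 s0 t0.
have expE (r x : R) : (0 < r)%R ->
    (r < expR (- (g * x)))%R = (x < - ln r / g)%R.
  move=> r0; rewrite -[X in (X < _)%R]lnK ?posrE// ltr_expR.
  by rewrite ltr_pdivlMr// mulrC ltrNr.
by congr (_ `&` _); apply/funext => w /=; rewrite s0 t0 !expE.
Qed.

Lemma le_integral_exp (g : R) : (0 < g)%R ->
  \int[m1]_(w in D1) (expR (- (g * (X1 w + Y1 w))))%:E <=
  \int[m2]_(w in D2) (expR (- (g * (X2 w + Y2 w))))%:E.
Proof.
move=> g0.
have expD (x y : R) :
    (expR (- (g * (x + y))) = expR (- (g * x)) * expR (- (g * y)))%R.
  by rewrite mulrDr opprD expRD.
under eq_integral do rewrite expD.
under [leRHS]eq_integral do rewrite expD.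
have e0 (x : R) : (0 <= expR x)%R by exact: expR_ge0.
rewrite !integral_mul_layer//; do ?exact: measurable_expN.
apply: ge0_le_integral => //.
- by apply: measurable_measure_layer => //; exact: measurable_expN.
- by apply: measurable_measure_layer => //; exact: measurable_expN.
move=> [s t] _; rewrite /layer/=.
(* At a nonpositive level the left layer is empty and there is nothing to compare. *)
have [s0|s0] := ltP 0%R s; last first.
  rewrite (_ : D1 `&` _ = set0) ?measure0//.
  by rewrite -subset0 => w /= [_ []].
have [t0|t0] := ltP 0%R t; last first.
  rewrite (_ : D1 `&` _ = set0) ?measure0//.
  by rewrite -subset0 => w /= [_ [_]].
have := layer_exp D1 X1 Y1 g0 s0 t0; rewrite s0 t0 => ->.
by have := layer_exp D2 X2 Y2 g0 s0 t0; rewrite s0 t0 => ->.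
Qed.

Variables (c : R) (F : cumulativeBounded (0 : R) c).
Hypothesis F_supp : compactly_supported_in_pos F.

(** Tonelli exchanges the expectation with the mixture over [g]. The measurability in [g] is
    recorded alongside, being needed to integrate the inequality obtained for each fixed [g]. *)
Let integral_utilityE (d : measure_display) (T : measurableType d)
    (m : {sigma_finite_measure set T -> \bar R}) (D : set T) (X Y : T -> R) :
  measurable D -> measurable_fun setT X -> measurable_fun setT Y ->
  \int[m]_(w in D) (- utility F (X w + Y w)%R)%:E =
  \int[lebesgue_stieltjes_measure F]_(g in `]0%R, +oo[)
     \int[m]_(w in D) (expR (- (g * (X w + Y w))))%:E /\
  measurable_fun (`]0%R, +oo[ : set R) (fun g : R =>
     \int[m]_(w in D) (expR (- (g * (X w + Y w))))%:E).
Proof.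
move=> mD mX mY.
pose f (q : T * R) := (expR (- (q.2 * (X q.1 + Y q.1))))%:E.
have mf : measurable_fun setT f.
  apply/measurable_EFinP; apply: measurableT_comp => //.
  apply: measurable_funN; apply: measurable_funM => //.
  by apply: measurable_funD; exact: measurableT_comp.
have f0 q : 0 <= f q by rewrite lee_fin expR_ge0.
split; last first.
  have mI : measurable (`]0%R, +oo[%classic : set (measurableTypeR R)) by [].
  exact: (measurable_ge0_fubini_in m mD mI mf f0).
under eq_integral do rewrite -exp_integralE//.
exact: (@ge0_fubini_in _ _ _ _ _ m (lebesgue_stieltjes_measure F) D
  `]0%R, +oo[ f).
Qed.

Lemma le_integral_utility :
  \int[m1]_(w in D1) (- utility F (X1 w + Y1 w)%R)%:E <=
  \int[m2]_(w in D2) (- utility F (X2 w + Y2 w)%R)%:E.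
Proof.
have [-> mI1] := integral_utilityE m1 mD1 mX1 mY1.
have [-> mI2] := integral_utilityE m2 mD2 mX2 mY2.
apply: ge0_le_integral; [by []| |exact: mI1|exact: mI2|].
  by move=> g _; apply: integral_ge0 => w _; rewrite lee_fin expR_ge0.
by move=> g; rewrite /= in_itv/= andbT => g0; exact: le_integral_exp.
Qed.

End exp_comparison.

(** * Continuity from below, uniqueness of laws and cofinal sequences *)

Lemma lt_probability_bigcup (d : measure_display) (T : measurableType d)
    (R : realType) (P : probability T R) (E : (set T)^nat)
    (a : \bar R) :
  (forall n, measurable (E n)) -> (forall n m, (n <= m)%N -> E n `<=` E m) ->
  (a < P (\bigcup_n E n))%E -> exists n, (a < P (E n))%E.
Proof.
move=> mE ndE aE; apply: contrapT => /forallNP Ea.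
move: aE; apply/negP; rewrite -leNgt.
(* By continuity from below, a bound valid for every [E n] would pass to the union. *)
have cvgE : (P \o E) n @[n --> \oo] --> P (\bigcup_n E n).
  apply: nondecreasing_cvg_mu => //; first exact: bigcupT_measurable.
  by move=> n m nm; apply/subsetPset; exact: ndE.
rewrite -(cvg_lim _ cvgE)//; apply: lime_le; first by apply: cvgP cvgE.
by apply: nearW => n /=; rewrite leNgt; apply/negP; exact: Ea.
Qed.

(** The open lower rays generate the Borel sets and are stable under intersection. Open rays match
    the strict inequalities that the layers produce. *)
Lemma measure_real_unique (R : realType)
    (m1 m2 : {measure set R -> \bar R}) :
  (forall t : R, m1 `]-oo, t[%classic = m2 `]-oo, t[%classic) ->
  (forall t : R, (m1 `]-oo, t[%classic < +oo)%E) ->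
  forall A, measurable A -> m1 A = m2 A.
Proof.
move=> m12 m1oo.
apply: (measure_unique (@RGenInftyO.G R) (fun n => `]-oo, n%:R[%classic)).
- exact: RGenInftyO.measurableE.
- move=> _ _ [s ->] [t ->]; exists (Num.min s t).
  apply/seteqP; split=> x /=; rewrite !in_itv/= lt_min.
    by move=> [-> ->].
  by move=> /andP[].
- by move=> n; exists n%:R.
- rewrite -subTset => x _; exists (Num.truncn `|x|).+1 => //=.
  by rewrite in_itv/= (le_lt_trans (ler_norm _))// truncnS_gt.
- by move=> _ [t ->]; exact: m12.
- by move=> n; exact: m1oo.
Qed.

(** Three cases: the integers if [A] is unbounded above, the constant [sup A] if it belongs to [A],
    and otherwise an increasing sequence approaching [sup A] from below. *)
Lemma down_closed_cofinal (R : realType) (A : set R) :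
  A !=set0 -> (forall x y, x <= y -> A y -> A x) ->
  exists a : nat -> R, [/\ forall n, A (a n),
    forall n m, (n <= m)%N -> a n <= a m & forall x, A x -> exists n, x <= a n].
Proof.
move=> A0 downA; have [ubA|nubA] := pselect (has_ubound A); last first.
  exists (fun n => n%:R); split => [n|n m nm|x Ax].
  - apply: contrapT => An; apply: nubA; exists n%:R => x Ax.
    by rewrite leNgt; apply/negP => /ltW nx; apply: An; exact: downA Ax.
  - by rewrite ler_nat.
  - exists (Num.truncn `|x|).+1.
    by rewrite (le_trans (ler_norm _))// ltW// truncnS_gt.
have [supA|supA] := pselect (A (sup A)).
  exists (fun=> sup A); split => // x Ax; exists 0%N; exact: ub_le_sup.
exists (fun n => sup A - n.+1%:R^-1); split => [n|n m nm|x Ax].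
- have [//|y Ay supy] := @sup_adherent _ A (n.+1%:R^-1) _ (conj A0 ubA).
  by apply: downA Ay; exact: ltW.
- by rewrite lerD2l lerN2 lef_pV2 ?posrE// ler_nat.
- have xsup : x < sup A.
    rewrite lt_neqAle ub_le_sup// andbT; apply/eqP => xE.
    by apply: supA; rewrite -xE.
  have /ltr_add_invr[n xn] := xsup.
  by exists n; rewrite lerBrDr ltW.
Qed.

(** * Quantile functions *)

Section quantile_theory.
Context (R : realType) (d : measure_display) (T : measurableType d).
Variables (P : probability T R) (X : {RV P >-> R}).

Local Notation plt s := (P (X @^-1` `]-oo, s[%classic)).

Let Q := quantile_oo X.

Let S (p : R) := [set z : R | (p%:E < cdf X z)%E].

Let S_neq0 (p : R) : p < 1 -> S p !=set0.
Proof.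
move=> p1.
have [n pn] : exists n : nat, (p%:E < P (X @^-1` `]-oo, n%:R]%classic))%E.
  apply: lt_probability_bigcup => [n|n m nm w|].
- by apply: measurable_funPTI.
- by rewrite /= !in_itv/= => /le_trans; apply; rewrite ler_nat.
- suff -> : \bigcup_n (X @^-1` `]-oo, n%:R]%classic) = setT.
    by rewrite probability_setT lte_fin.
  rewrite -subTset => w _; exists (Num.truncn `|X w|).+1 => //=.
  by rewrite in_itv/= (le_trans (ler_norm _))// ltW// truncnS_gt.
by exists n%:R.
Qed.

Let S_lbound (p : R) : 0 < p -> has_lbound (S p).
Proof.
move=> p0.
(* With [P (X > - n)] above [1 - p], the distribution function is at most [p] left of [- n], so no
   element of [S p] lies there. *)
have [n pn] : exists n : nat,
    ((1 - p)%:E < P (X @^-1` `](- n%:R)%R, +oo[%classic))%E.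
  apply: lt_probability_bigcup => [n|n m nm w|].
- by apply: measurable_funPTI.
- by rewrite /= !in_itv/= !andbT; apply: le_lt_trans; rewrite lerN2 ler_nat.
- suff -> : \bigcup_n (X @^-1` `](- n%:R)%R, +oo[%classic) = setT.
    by rewrite probability_setT lte_fin ltrBlDr ltrDl.
  rewrite -subTset => w _; exists (Num.truncn `|X w|).+1 => //=.
  rewrite in_itv/= andbT ltrNl (le_lt_trans (ler_norm _))// normrN truncnS_gt//.
exists (- n%:R) => z; rewrite /S/= => pz; rewrite leNgt; apply/negP => zn.
move: pz; apply/negP; rewrite -leNgt.
rewrite -[cdf X z]/(P (X @^-1` `]-oo, z])).
apply: (@le_trans _ _ (P (~` (X @^-1` `](- n%:R)%R, +oo[%classic)))).
  apply: le_measure; rewrite ?inE.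
  - exact: measurable_funPTI.
  - by apply: measurableC; exact: measurable_funPTI.
  move=> w; rewrite /= !in_itv/= andbT => Xz; apply/negP.
  by rewrite -leNgt (le_trans Xz)// ltW.
rewrite probability_setC; last exact: measurable_funPTI.
have fP : P (X @^-1` `](- n%:R), +oo[%classic) \is a fin_num.
  by rewrite fin_num_measure//; exact: measurable_funPTI.
move: pn; rewrite -(fineK fP) lte_fin -EFinB lee_fin => pn.
by rewrite lerBlDr addrC -lerBlDr ltW.
Qed.

(** The strict inequality in the definition of the quantile makes this equivalence exact, atoms or
    not: a point of [S p] below [s] bounds [P (X < s)] from below, and conversely the event [X < s]
    is the increasing union of the events [X <= s - 1/(n+1)]. *)
Lemma quantile_oo_lt (p s : R) : 0 < p < 1 -> (Q p < s) <-> (p%:E < plt s)%E.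
Proof.
move=> /andP[p0 p1]; split.
  move=> /inf_lt-/(_ (S_neq0 p1))[z pz zs].
  apply: (lt_le_trans pz); rewrite -[cdf X z]/(P (X @^-1` `]-oo, z])).
  apply: le_measure; rewrite ?inE.
  - exact: measurable_funPTI.
  - exact: measurable_funPTI.
  by move=> w; rewrite /= !in_itv/= => /le_lt_trans; exact.
move=> ps.
have [n pn] : exists n : nat,
    (p%:E < P (X @^-1` `]-oo, (s - n.+1%:R^-1)%R]%classic))%E.
  apply: lt_probability_bigcup => [n|n m nm w|].
- by apply: measurable_funPTI.
- rewrite /= !in_itv/= => /le_trans; apply.
  by rewrite lerD2l lerN2 lef_pV2 ?posrE// ler_nat.
- rewrite (_ : \bigcup_n _ = X @^-1` `]-oo, s[%classic)//.
  apply/seteqP; split=> [w [n _]|w]/=; rewrite !in_itv/=.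
    by move=> /le_lt_trans; apply; rewrite ltrBlDr ltrDl.
  move=> /ltr_add_invr[n Xn]; exists n => //=.
  by rewrite in_itv/= lerBrDr ltW.
apply: (@le_lt_trans _ _ (s - n.+1%:R^-1)); last by rewrite ltrBlDr ltrDl.
by apply: ge_inf => //; exact: S_lbound.
Qed.

Lemma quantile_oo_lt_itv (s : R) :
  `]0, 1[ `&` [set p | Q p < s] = `]0, 1[ `&` [set p | (p%:E < plt s)%E].
Proof.
apply/seteqP; split=> p [/= p01]; have := p01; rewrite in_itv/= => p01';
  by split => //; apply/(quantile_oo_lt _ p01').
Qed.

Lemma measurable_plt_itv (s : R) :
  measurable (`]0, 1[ `&` [set p | (p%:E < plt s)%E] : set R).
Proof.
rewrite (_ : _ `&` _ = `]0, 1[ `&` `]-oo, fine (plt s)[%classic).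
  exact: measurableI.
congr (_ `&` _); apply/seteqP; split=> p/=; rewrite in_itv/=.
  by rewrite -lte_fin fineK// fin_num_measure//; exact: measurable_funPTI.
by rewrite -lte_fin fineK// fin_num_measure//; exact: measurable_funPTI.
Qed.

Lemma measurable_quantile_oo : measurable_fun setT (Q \_ `]0, 1[).
Proof.
apply/(measurable_restrictT _ _).1 => // mD.
apply: (measurability _ (RGenInftyO.measurableE R)) => //= _ [_ [x ->] <-].
rewrite (_ : _ `&` _ = `]0, 1[ `&` [set p | Q p < x]).
  by rewrite quantile_oo_lt_itv; exact: measurable_plt_itv.
by congr (_ `&` _); apply/seteqP; split=> p /=; rewrite in_itv.
Qed.

End quantile_theory.

(** * The lexicographic rank of [(X, Z)] and its uniform law *)

Section lexicographic_rank.
Context (R : realType) (d : measure_display) (T : measurableType d).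
Variables (P : probability T R) (X Z : T -> R).
Hypotheses (mX : measurable_fun setT X) (mZ : measurable_fun setT Z).

(** The pullback by [(X, Z)] of the principal lower set of [(x, z)] in the lexicographic order; [Z]
    breaks the ties left by the atoms of [X]. *)
Definition lex_below (x z : R) : set T :=
  [set w | (X w < x) || (X w == x) && (Z w <= z)].

Definition lex_rank (w : T) : R := fine (P (lex_below (X w) (Z w))).

Lemma measurable_lex_below x z : measurable (lex_below x z).
Proof.
rewrite -[X in measurable X]setTI /lex_below.
apply: (@measurable_or _ _ _ (fun w => X w < x)
  (fun w => (X w == x) && (Z w <= z))) => //.
  exact: measurable_fun_ltr.
by apply: measurable_and; [exact: measurable_fun_eqr|exact: measurable_fun_ler].
Qed.

Lemma lex_rankE w : (lex_rank w)%:E = P (lex_below (X w) (Z w)).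
Proof. by rewrite fineK// fin_num_measure//; exact: measurable_lex_below. Qed.

Lemma measurable_lex_rank : measurable_fun setT lex_rank.
Proof.
(* The section of this set at [w] is the lower set of [w], so the rank is the measure of a section
   and therefore measurable. *)
pose A : set (T * T) := [set q | (X q.2 < X q.1) ||
  (X q.2 == X q.1) && (Z q.2 <= Z q.1)].
have mA : measurable A.
  rewrite -[X in measurable X]setTI /A.
  have mX1 : measurable_fun setT (fun q : T * T => X q.1).
    exact: measurableT_comp.
  have mX2 : measurable_fun setT (fun q : T * T => X q.2).
    exact: measurableT_comp.
  have mZ1 : measurable_fun setT (fun q : T * T => Z q.1).
    exact: measurableT_comp.
  have mZ2 : measurable_fun setT (fun q : T * T => Z q.2).
    exact: measurableT_comp.
  apply: (@measurable_or _ _ _ (fun q : T * T => X q.2 < X q.1)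
    (fun q => (X q.2 == X q.1) && (Z q.2 <= Z q.1))) => //.
    exact: measurable_fun_ltr.
  by apply: measurable_and;
    [exact: measurable_fun_eqr|exact: measurable_fun_ler].
have := measurable_fun_xsection P mA.
rewrite (_ : P \o xsection A = EFin \o lex_rank).
  by move/measurable_EFinP.
apply/funext => w /=; rewrite lex_rankE; congr (P _).
by apply/seteqP; split=> w'; rewrite /xsection/= inE.
Qed.

(** If [s <= X w], the whole event [X < s] lies lexicographically below [w], and the rank of [w] is
    at least its probability. *)
Lemma lex_below_lt_rank w s : lex_rank w < fine (P (X @^-1` `]-oo, s[)) ->
  X w < s.
Proof.
rewrite -lte_fin lex_rankE fineK; last first.
  by rewrite fin_num_measure// -[X in measurable X]setTI; exact: mX.
apply: contraTT; rewrite -!leNgt => sX.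
apply: le_measure; rewrite ?inE; last 1 first.
- by move=> w'; rewrite /lex_below/= in_itv/= => /lt_le_trans ->.
- by rewrite -[X in measurable X]setTI; exact: mX.
- exact: measurable_lex_below.
Qed.

Lemma lex_below_subset x z x' z' : (x < x') || (x == x') && (z <= z') ->
  lex_below x z `<=` lex_below x' z'.
Proof.
move=> le w; rewrite /lex_below/=.
case/orP: le => [xx'|/andP[/eqP<- zz']].
  case/orP => [wx|/andP[/eqP-> _]]; last by rewrite xx'.
  by rewrite (lt_trans wx).
by case/orP => [->//|/andP[-> Zz]]; rewrite (le_trans Zz)// orbT.
Qed.

(* The lower sets of the lexicographic order have countable cofinal chains, so
   a lower set all of whose principal sections have mass at most [t] has mass
   at most [t]. *)
Lemma lex_rank_le (t : R) : 0 <= t ->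
  (P [set w | (lex_rank w <= t)%R] <= t%:E)%E.
Proof.
move=> t0.
pose S := [set q : R * R | (P (lex_below q.1 q.2) <= t%:E)%E].
have downS x z x' z' : (x < x') || (x == x') && (z <= z') -> S (x', z') ->
    S (x, z).
  move=> le; apply: le_trans; apply: le_measure; rewrite ?inE;
    by [exact: measurable_lex_below|exact: lex_below_subset].
have mrank : measurable [set w | lex_rank w <= t].
  by rewrite -[X in measurable X]setTI; apply: measurable_fun_ler => //;
    exact: measurable_lex_rank.
have rankS w : lex_rank w <= t -> S (X w, Z w).
  by rewrite -lee_fin lex_rankE.
(* Along such a chain the event is covered by an increasing union of lower sets, each of mass at
   most [t]. *)
suff chain : [set w | lex_rank w <= t] !=set0 -> exists a : nat -> R * R,
    [/\ forall n, S (a n),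
    forall n m, (n <= m)%N -> ((a n).1 < (a m).1) ||
      ((a n).1 == (a m).1) && ((a n).2 <= (a m).2) &
    forall x z, S (x, z) ->
      exists n, (x < (a n).1) || (x == (a n).1) && (z <= (a n).2)].
  have [/eqP->|/set0P/chain[a [Sa nda cofa]]] :=
    boolP ([set w | lex_rank w <= t] == set0); first by rewrite measure0.
  rewrite leNgt; apply/negP => tlt.
  have [n] : exists n, (t%:E < P (lex_below (a n).1 (a n).2))%E.
    apply: lt_probability_bigcup => [n|n m nm|].
    - exact: measurable_lex_below.
    - by apply: lex_below_subset; exact: nda.
    apply: (lt_le_trans tlt); apply: le_measure; rewrite ?inE//.
      by apply: bigcupT_measurable => n; exact: measurable_lex_below.
    by move=> w /rankS/cofa[n an]; exists n.
  by rewrite ltNge; apply/negP; rewrite negbK; exact: Sa.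
move=> [w0 /rankS S0].
pose A := [set x | exists z, S (x, z)].
have downA x y : x <= y -> A y -> A x.
  rewrite le_eqVlt => /orP[/eqP->//|xy] [z Sz]; exists z.
  by apply: downS Sz; rewrite xy.
(* If the first coordinates of [S] have a maximum [a], the chain climbs the fibre over [a];
   otherwise it climbs in the first coordinate. *)
have [[a [[za Sa] amax]]|nmax] :=
  pselect (exists a, A a /\ forall x, A x -> x <= a).
  have [||z [Sz ndz cofz]] := @down_closed_cofinal _ [set z | S (a, z)].
  - by exists za.
  - by move=> z z' zz'; apply: downS; rewrite eqxx zz' orbT.
  exists (fun n => (a, z n)); split => [n|n m nm|x y Sxy] /=.
  - exact: Sz.
  - by rewrite eqxx ndz// orbT.
  have : x <= a by apply: amax; exists y.
  rewrite le_eqVlt => /orP[/eqP xa|xa]; last by exists 0%N; rewrite xa.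
  rewrite xa in Sxy *; have [n yn] := cofz _ Sxy.
  by exists n; rewrite eqxx yn orbT.
have gtA x : A x -> exists2 y, A y & x < y.
  move=> Ax; apply: contrapT => noy; apply: nmax; exists x; split => // y Ay.
  by rewrite leNgt; apply/negP => xy; apply: noy; exists y.
have [|//|x [Ax ndx cofx]] := @down_closed_cofinal _ A.
  by exists (X w0), (Z w0).
(* The second coordinate is arbitrary: since [A] has no maximum, [(x n, 0)] lies below a point of
   [S] with a larger first coordinate. *)
exists (fun n => (x n, 0)); split => [n|n m nm|y z Sy] /=.
- by have [y [z Sy] xy] := gtA _ (Ax n); apply: downS Sy; rewrite xy.
- by rewrite lexx andbT orbC -le_eqVlt ndx.
have [|y' Ay' yy'] := gtA y; first by exists z.
have [n yn] := cofx _ Ay'.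
by exists n; rewrite (lt_le_trans yy').
Qed.

End lexicographic_rank.

Section rank_uniform.
Context (R : realType) (d : measure_display) (T : measurableType d).
Variables (P : probability T R) (X Z : T -> R).
Hypotheses (mX : measurable_fun setT X) (mZ : measurable_fun setT Z).
Hypothesis Z_atomless : forall z, P (Z @^-1` [set z]) = 0%E.

Local Notation U := (lex_rank P X Z).

(** The lower set of [w] in the reversed order is the complement of its lower set, up to the event
    [Z = Z w], which is null. *)
Lemma lex_rankN w : lex_rank P (\- X) (\- Z) w = 1 - U w.
Proof.
have mNX : measurable_fun setT (\- X) by exact: measurable_funN.
have mNZ : measurable_fun setT (\- Z) by exact: measurable_funN.
have mL := measurable_lex_below mX mZ (X w) (Z w).
have mL' := measurable_lex_below mNX mNZ (- X w) (- Z w).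
have mZw : measurable (Z @^-1` [set Z w]).
  by rewrite -[X in measurable X]setTI; exact: mZ.
apply: EFin_inj; rewrite lex_rankE// EFinB lex_rankE// -probability_setC//.
apply/eqP; rewrite eq_le; apply/andP; split.
  rewrite -[leRHS]adde0 -(Z_atomless (Z w)).
  apply: le_trans (measureU2 _ _ _) => //; last exact: measurableC.
  apply: le_measure; rewrite ?inE//.
    by apply: measurableU => //; exact: measurableC.
  move=> w'; rewrite /lex_below/= ltrN2 eqr_opp lerN2.
  have [ZE|ZE] := eqVneq (Z w') (Z w); first by right.
  move=> le; left; apply/negP; case/orP: le => [lt|/andP[/eqP-> Zle]].
    by rewrite negb_or -leNgt (ltW lt)/= gt_eqF.
  by rewrite ltxx eqxx/= -ltNge lt_neqAle eq_sym ZE.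
apply: le_measure; rewrite ?inE//; first exact: measurableC.
move=> w'; rewrite /lex_below/= ltrN2 eqr_opp lerN2 => /negP.
rewrite negb_or -leNgt le_eqVlt eq_sym => /andP[/orP[/eqP->|->//]].
by rewrite eqxx/= -ltNge ltxx/= => /ltW.
Qed.

(** [lex_rank_le] bounds the distribution function of [U] from above; applied to the reversed order,
    where the rank is [1 - U], it bounds it from below. *)
Lemma lex_rank_uniform (A : set R) : measurable A ->
  P (U @^-1` A) = lebesgue_measure (`]0, 1[ `&` A).
Proof.
have mU := measurable_lex_rank P mX mZ.
have mNX : measurable_fun setT (\- X) by exact: measurable_funN.
have mNZ : measurable_fun setT (\- Z) by exact: measurable_funN.
have mpre (B : set R) : measurable B -> measurable (U @^-1` B).
  by move=> mB; rewrite -[X in measurable X]setTI; exact: mU.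
have U0 w : 0 <= U w by exact: fine_ge0.
have cdfU t : 0 <= t <= 1 -> P (U @^-1` `]-oo, t[) = t%:E.
  move=> /andP[t0 t1]; apply/eqP; rewrite eq_le; apply/andP; split.
    apply: le_trans (lex_rank_le P mX mZ t0).
    apply: le_measure; rewrite ?inE.
    - exact: mpre.
    - by have := mpre _ (@measurable_itv _ `]-oo, t]).
    by move=> w /=; rewrite in_itv/= => /ltW.
  have := lex_rank_le P mNX mNZ (t := 1 - t); rewrite subr_ge0 => /(_ t1).
  rewrite (_ : [set w | _] = ~` (U @^-1` `]-oo, t[)).
    rewrite probability_setC; last exact: mpre.
    rewrite -(@fineK _ (P (U @^-1` _))); last first.
      by rewrite fin_num_measure//; exact: mpre.
    by rewrite -EFinB !lee_fin lerD2l lerN2.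
  apply/seteqP; split=> w /=; rewrite lex_rankN in_itv/= lerD2l lerN2.
    by rewrite leNgt => /negP.
  by move=> /negP; rewrite -leNgt.
pose UR : {mfun T >-> R} := mfun_Sub (mem_set mU).
move=> mA; rewrite setIC.
have m01 : measurable (`]0, 1[%classic : set (measurableTypeR R)) by [].
pose m : {measure set (measurableTypeR R) -> \bar R} :=
  mrestr lebesgue_measure m01.
have m_sigma_additive : semi_sigma_additive (m : set R -> \bar R).
  exact: (@measure_semi_sigma_additive _ _ _ m).
(* Lebesgue measure on []0, 1[], repackaged over the measurable structure of [R] itself to be
   compared with the law of [U]. *)
pose m2 := HB.pack_for {measure set R -> \bar R} (m : set R -> \bar R)
  (isMeasure.Build _ R R (m : set R -> \bar R) (measure0 m) (measure_ge0 m)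
     m_sigma_additive).
have := @measure_real_unique _ (distribution P UR) m2.
move=> uniq; apply: uniq mA => t; last first.
  by rewrite (le_lt_trans (probability_le1 _ _)) ?ltry//; exact: mpre.
rewrite /m2/= /m /mrestr/= -[LHS]/(P (U @^-1` `]-oo, t[)).
have [t0|t0] := leP t 0.
  rewrite (_ : U @^-1` _ = set0); last first.
    rewrite -subset0 => w /=; rewrite in_itv/= => /lt_le_trans/(_ t0).
    by rewrite ltNge U0.
  rewrite (_ : _ `&` _ = set0) ?measure0// -subset0 => p/=.
  rewrite !in_itv/= => -[pt /andP[p0 _]].
  by have := lt_trans p0 (lt_le_trans pt t0); rewrite ltxx.
have [t1|t1] := leP t 1.
  rewrite cdfU ?(ltW t0)// (_ : _ `&` _ = `]0, t[%classic).
    by rewrite lebesgue_measure_itv/= lte_fin t0 sube0.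
  apply/seteqP; split=> p /=; rewrite !in_itv/=.
    by move=> [-> /andP[->]].
  by move=> /andP[-> pt]; rewrite pt (lt_le_trans pt).
rewrite (_ : _ `&` _ = `]0, 1[%classic); last first.
  apply/seteqP; split=> p /=; rewrite !in_itv/=; first by case.
  by move=> /andP[-> p1]; rewrite p1 (lt_trans p1).
rewrite lebesgue_measure_itv/= lte_fin ltr01 sube0.
apply/eqP; rewrite eq_le probability_le1/=; last exact: mpre.
rewrite -(cdfU 1) ?ler01 ?lexx//; apply: le_measure; rewrite ?inE.
- exact: mpre.
- exact: mpre.
by move=> w /=; rewrite !in_itv/= => /lt_trans; exact.
Qed.

End rank_uniform.

(** Made constant off []0, 1[], so that it is measurable on the whole line and can be composed with
    any real function. *)
Definition unit_quantile (R : realType) (d : measure_display)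
    (T : measurableType d) (P : probability T R) (Y : {RV P >-> R}) : R -> R :=
  quantile_oo Y \_ `]0, 1[.

(** * Couplings attaining the two Frechet bounds *)

Section coupling.
Context (R : realType) (d : measure_display) (T : measurableType d).
Variables (P : probability T R) (X theta : {RV P >-> R}) (Z : T -> R).
Hypothesis mZ : measurable_fun setT Z.
Hypothesis Z_atomless : forall z, P (Z @^-1` [set z]) = 0%E.

Local Notation U := (lex_rank P X Z).
Local Notation leb := (@lebesgue_measure R).
Local Notation plt Y s := (fine (P (Y @^-1` `]-oo, s[%classic))).

Local Notation Q := unit_quantile.

Definition comonotone_copy : T -> R := Q theta \o U.

Definition antimonotone_copy : T -> R := (fun p : R => Q theta (1 - p)) \o U.

Let mX : measurable_fun setT X.
Proof. exact: measurable_funPT. Qed.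

Let mU : measurable_fun setT U := measurable_lex_rank P mX mZ.

Let mQ (Y : {RV P >-> R}) : measurable_fun setT (Q Y) :=
  measurable_quantile_oo Y.

Let mQa : measurable_fun setT (fun p : R => Q theta (1 - p)).
Proof. by apply: measurableT_comp => //; exact: measurable_funB. Qed.

Let mpre (f : T -> R) (A : set R) : measurable_fun setT f -> measurable A ->
  measurable (f @^-1` A).
Proof. by move=> mf mA; rewrite -[X in measurable X]setTI; exact: mf. Qed.

Let pltE (Y : {RV P >-> R}) s : (plt Y s)%:E = P (Y @^-1` `]-oo, s[).
Proof. by rewrite fineK// fin_num_measure//; exact: measurable_funPTI. Qed.

Let plt01 (Y : {RV P >-> R}) s : 0 <= plt Y s <= 1.
Proof.
rewrite -!lee_fin pltE measure_ge0 probability_le1//.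
exact: measurable_funPTI.
Qed.

Let QltE (Y : {RV P >-> R}) s p : 0 < p < 1 -> (Q Y p < s) = (p < plt Y s).
Proof.
move=> p01; rewrite /unit_quantile patchE mem_set/= ?in_itv//.
apply/idP/idP => [/(quantile_oo_lt _ _ p01)|ps].
  by rewrite -pltE lte_fin.
by apply/(quantile_oo_lt _ _ p01); rewrite -pltE lte_fin.
Qed.

(** Both events are initial intervals of []0, 1[]; the length of their intersection is the upper
    Frechet bound. *)
Let joint_comonotone_itv (Y : {RV P >-> R}) s t :
  `]0, 1[ `&` [set p | Q X p < s /\ Q Y p < t] =
  `]0, Num.min (plt X s) (plt Y t)[%classic.
Proof.
apply/seteqP; split=> p /=; rewrite !in_itv/=.
  by move=> [p01]; rewrite !QltE// lt_min => -[-> ->]; case/andP: p01 => ->.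
rewrite lt_min => /and3P[p0 ps pt].
have p01 : 0 < p < 1.
  by rewrite p0 (lt_le_trans ps)//; case/andP: (plt01 X s).
by rewrite !QltE.
Qed.

(** An initial and a final interval of []0, 1[]; the length of their overlap is the lower Frechet
    bound, the positive part of [P (X < s) + P (theta < t) - 1]. *)
Let joint_antimonotone_itv s t :
  `]0, 1[ `&` [set p | Q X p < s /\ Q theta (1 - p) < t] =
  `](1 - plt theta t), (plt X s)[%classic.
Proof.
have sub01 p : 0 < p < 1 -> 0 < 1 - p < 1.
  by move=> /andP[p0 p1]; rewrite subr_gt0 p1 ltrBlDr ltrDl.
apply/seteqP; split=> p /=; rewrite !in_itv/=.
  by move=> [p01]; rewrite !QltE ?sub01// ltrBlDr addrC -ltrBlDr => -[-> ->].
move=> /andP[tp ps]; have p01 : 0 < p < 1.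
  rewrite (lt_le_trans ps)/= ?andbT; last by case/andP: (plt01 X s).
  by apply: le_lt_trans tp; rewrite subr_ge0; case/andP: (plt01 theta t).
by rewrite !QltE ?sub01// ps ltrBlDr addrC -ltrBlDr.
Qed.

(* [X < s] and [U < P (X < s)] differ by a null set, the latter being contained
   in the former and of the same probability. *)
Let joint_law (G : R -> R) s t : measurable_fun setT G ->
  P [set w | X w < s /\ G (U w) < t] =
  leb (`]0, 1[ `&` [set p | Q X p < s /\ G p < t]).
Proof.
move=> mG.
have mGt : measurable (G @^-1` `]-oo, t[).
  by rewrite -[X in measurable X]setTI; exact: mG.
have mXs : measurable (X @^-1` `]-oo, s[) by exact: measurable_funPTI.
have mUs : measurable (U @^-1` `]-oo, plt X s[) by exact: mpre.
have UX : U @^-1` `]-oo, plt X s[ `<=` X @^-1` `]-oo, s[.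
  by move=> w /=; rewrite !in_itv/=; exact: lex_below_lt_rank.
have PUs : P (U @^-1` `]-oo, plt X s[) = P (X @^-1` `]-oo, s[).
  rewrite lex_rank_uniform// -pltE -[RHS]lebesgue_measure_itv0; last first.
    by case/andP: (plt01 X s).
  congr (leb _); apply/seteqP; split=> p /=; rewrite !in_itv/=.
    by move=> [/andP[-> _] ->].
  move=> /andP[-> ps]; rewrite ps (lt_le_trans ps)//.
  by case/andP: (plt01 X s).
have -> : leb (`]0, 1[ `&` [set p | Q X p < s /\ G p < t]) =
    P (U @^-1` (`]-oo, plt X s[ `&` G @^-1` `]-oo, t[)).
  rewrite lex_rank_uniform//; last exact: measurableI.
  congr (leb _); apply/seteqP; split=> p /=; rewrite !in_itv/=.
    by move=> [p01]; rewrite QltE.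
  by move=> [p01]; rewrite QltE.
have -> : [set w | X w < s /\ G (U w) < t] =
    X @^-1` `]-oo, s[ `&` (G \o U) @^-1` `]-oo, t[.
  by apply/seteqP; split=> w /=; rewrite !in_itv.
have mGU : measurable ((G \o U) @^-1` `]-oo, t[).
  by apply: mpre => //; exact: measurableT_comp.
have mI : measurable (X @^-1` `]-oo, s[ `&` (G \o U) @^-1` `]-oo, t[).
  exact: measurableI.
apply/eqP; rewrite eq_le; apply/andP; split; last first.
  apply: le_measure; rewrite ?inE//.
    by rewrite preimage_setI; exact: measurableI.
  by move=> w [/UX].
have PD0 : P (X @^-1` `]-oo, s[ `\` U @^-1` `]-oo, plt X s[) = 0%E.
  rewrite measureD//; last first.
    by rewrite -ge0_fin_numE// fin_num_measure.
  rewrite setIidr// [X in (_ - X)%E]PUs.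
  by rewrite subee// fin_num_measure.
rewrite -[leRHS]adde0 -PD0.
apply: le_trans (measureU2 _ _ _).
- apply: le_measure; rewrite ?inE//.
    apply: measurableU; last exact: measurableD.
    by rewrite preimage_setI; exact: measurableI.
  move=> w [Xw Gw]; have [Uw|Uw] := pselect ((U @^-1` `]-oo, plt X s[) w).
    by left.
  by right.
- by rewrite preimage_setI; exact: measurableI.
- exact: measurableD.
Qed.

Let copy_law (G : R -> R) : measurable_fun setT G ->
  (forall t, leb (`]0, 1[ `&` [set p | G p < t]) = (plt theta t)%:E) ->
  forall A, measurable A -> P ((G \o U) @^-1` A) = distribution P theta A.
Proof.
move=> mG Glt A mA.
have mGU : measurable_fun setT (G \o U) by exact: measurableT_comp.
pose Y : {mfun T >-> R} := mfun_Sub (mem_set mGU).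
have uniq := @measure_real_unique _ (distribution P Y) (distribution P theta).
apply: uniq mA => t; last first.
  by rewrite (le_lt_trans (probability_le1 _ _)) ?ltry//; exact: mpre.
rewrite -[RHS]pltE -Glt -[LHS]/(P (U @^-1` (G @^-1` `]-oo, t[))).
have mGt : measurable (G @^-1` `]-oo, t[).
  by rewrite -[X in measurable X]setTI; exact: mG.
by rewrite lex_rank_uniform.
Qed.

Lemma measurable_comonotone_copy : measurable_fun setT comonotone_copy.
Proof. exact: measurableT_comp. Qed.

Lemma measurable_antimonotone_copy : measurable_fun setT antimonotone_copy.
Proof. by apply: measurableT_comp. Qed.

Definition comonotone_rv : {RV P >-> R} :=
  mfun_Sub (mem_set measurable_comonotone_copy).

Definition antimonotone_rv : {RV P >-> R} :=
  mfun_Sub (mem_set measurable_antimonotone_copy).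

Lemma comonotone_rv_law : same_law comonotone_rv theta.
Proof.
move=> A mA; apply: (@copy_law (Q theta)) => // t.
rewrite -lebesgue_measure_itv0; last by case/andP: (plt01 theta t).
congr (leb _); apply/seteqP; split=> p /=; rewrite !in_itv/=.
  by move=> [p01]; rewrite QltE// => ->; case/andP: p01 => ->.
move=> /andP[p0 pt]; have p01 : 0 < p < 1.
  by rewrite p0 (lt_le_trans pt)//; case/andP: (plt01 theta t).
by rewrite QltE.
Qed.

Lemma antimonotone_rv_law : same_law antimonotone_rv theta.
Proof.
move=> A mA; apply: (@copy_law (fun p => Q theta (1 - p))) => // t.
have sub01 p : 0 < p < 1 -> 0 < 1 - p < 1.
  by move=> /andP[p0 p1]; rewrite subr_gt0 p1 ltrBlDr ltrDl.
have /andP[t0 t1] := plt01 theta t.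
rewrite (_ : _ `&` _ = `](1 - plt theta t), 1[%classic).
  rewrite lebesgue_measure_itv/= lte_fin ltrBlDr ltrDl.
  move: t0; rewrite le_eqVlt => /orP[/eqP<-|t0]; first by rewrite ltxx.
  by rewrite t0 -EFinD opprB addrC subrK.
apply/seteqP; split=> p /=; rewrite !in_itv/=.
  move=> [p01]; rewrite QltE ?sub01// ltrBlDr addrC -ltrBlDr => ->.
  by case/andP: p01.
move=> /andP[tp p1]; have p01 : 0 < p < 1.
  by rewrite p1 andbT (le_lt_trans _ tp)// subr_ge0.
by rewrite QltE ?sub01// ltrBlDr addrC -ltrBlDr.
Qed.

(** A joint event is no more likely than either of its marginal events. *)
Let joint_le_comonotone (Y : {RV P >-> R}) s t : same_law Y theta ->
  (P [set w | (X w < s)%R /\ (Y w < t)%R] <=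
   leb (`]0%R, 1%R[ `&` [set p | (Q X p < s)%R /\ (Q theta p < t)%R]))%E.
Proof.
move=> YE; rewrite joint_comonotone_itv lebesgue_measure_itv0; last first.
  by rewrite le_min; case/andP: (plt01 X s) => ->; case/andP: (plt01 theta t).
have mXY : measurable [set w | X w < s /\ Y w < t].
  rewrite (_ : [set w | _] = X @^-1` `]-oo, s[ `&` Y @^-1` `]-oo, t[).
    by apply: measurableI; exact: measurable_funPTI.
  by apply/seteqP; split=> w /=; rewrite !in_itv.
rewrite /Num.min; case: ifP => _; rewrite pltE.
  apply: le_measure; rewrite ?inE//; first exact: measurable_funPTI.
  by move=> w [Xs _] /=; rewrite in_itv.
rewrite -[leRHS]/(distribution P theta _) -YE//.
apply: le_measure; rewrite ?inE//; first exact: measurable_funPTI.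
by move=> w [_ Yt] /=; rewrite in_itv.
Qed.

(** The union bound on the complements of the two marginal events. *)
Let joint_ge_antimonotone (Y : {RV P >-> R}) s t : same_law Y theta ->
  (leb (`]0%R, 1%R[ `&` [set p | (Q X p < s)%R /\ (Q theta (1 - p)%R < t)%R]) <=
   P [set w | (X w < s)%R /\ (Y w < t)%R])%E.
Proof.
move=> YE; rewrite joint_antimonotone_itv lebesgue_measure_itv/= lte_fin.
case: ifPn => [ts|_]; last exact: measure_ge0.
have mX' : measurable (X @^-1` `]-oo, s[) by exact: measurable_funPTI.
have mY' : measurable (Y @^-1` `]-oo, t[) by exact: measurable_funPTI.
rewrite (_ : [set w | _] = X @^-1` `]-oo, s[ `&` Y @^-1` `]-oo, t[); last first.
  by apply/seteqP; split=> w /=; rewrite !in_itv.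
rewrite -[X @^-1` _ `&` _]setCK setCI probability_setC; last first.
  by apply: measurableU; exact: measurableC.
have PY : P (Y @^-1` `]-oo, t[) = (plt theta t)%:E by rewrite pltE; exact: YE.
have PU : (P (~` (X @^-1` `]-oo, s[) `|` ~` (Y @^-1` `]-oo, t[)) <=
    (1 - plt X s + (1 - plt theta t))%:E)%E.
  apply: le_trans (measureU2 _ _ _) _; [exact: measurableC..|].
  rewrite EFinD !EFinB -PY pltE.
  by apply: leeD; rewrite -probability_setC.
have mU' : measurable (~` (X @^-1` `]-oo, s[) `|` ~` (Y @^-1` `]-oo, t[)).
  by apply: measurableU; exact: measurableC.
have /EFin_fin_numP[v vE] := fin_num_measure P _ mU'.
move: PU; rewrite [X in (X <= _)%E -> _]vE [X in (_ - X)%E]vE.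
rewrite -EFinB -EFinD !lee_fin => PU.
rewrite lerBrDl (le_trans (lerD PU (lexx _)))//.
by rewrite addrACA subrK subrr addr0.
Qed.

Variables (c : R) (F : cumulativeBounded (0 : R) c).
Hypothesis F_supp : compactly_supported_in_pos F.

Local Notation disutility Y :=
  (\int[P]_w (- utility F (X w + Y w)%R)%:E)%E.

Let m01 : measurable (`]0, 1[%classic : set (measurableTypeR R)).
Proof. by []. Qed.

Let mQL (Y : {RV P >-> R}) :
  measurable_fun (setT : set (measurableTypeR R)) (Q Y).
Proof. exact: mQ. Qed.

Let mQaL : measurable_fun (setT : set (measurableTypeR R))
  (fun p : R => Q theta (1 - p)).
Proof. exact: mQa. Qed.

Let mY (Y : {RV P >-> R}) : measurable_fun setT Y.
Proof. exact: measurable_funPT. Qed.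

Lemma disutility_le_comonotone (Y : {RV P >-> R}) : same_law Y theta ->
  (disutility Y <= \int[leb]_(p in `]0%R, 1%R[)
    (- utility F (Q X p + Q theta p)%R)%:E)%E.
Proof.
move=> YE.
apply: (le_integral_utility (m1 := P) (m2 := leb) measurableT m01 mX (mY Y)
  (mQL X) (mQL theta) _ F_supp) => s t.
by rewrite setTI; exact: (joint_le_comonotone s t YE).
Qed.

Lemma disutility_ge_antimonotone (Y : {RV P >-> R}) : same_law Y theta ->
  (\int[leb]_(p in `]0%R, 1%R[)
    (- utility F (Q X p + Q theta (1 - p))%R)%:E <= disutility Y)%E.
Proof.
move=> YE.
apply: (le_integral_utility (m1 := leb) (m2 := P) m01 measurableT (mQL X) mQaL
  mX (mY Y) _ F_supp) => s t.
by rewrite setTI; exact: joint_ge_antimonotone.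
Qed.

(** One inequality is the general bound applied to the copy itself; the other is the same comparison
    with the roles of the two spaces exchanged, by [joint_law]. *)
Lemma disutility_comonotone : disutility comonotone_rv =
  (\int[leb]_(p in `]0%R, 1%R[) (- utility F (Q X p + Q theta p)%R)%:E)%E.
Proof.
apply/eqP; rewrite eq_le disutility_le_comonotone; last first.
  exact: comonotone_rv_law.
apply: (le_integral_utility (m1 := leb) (m2 := P) m01 measurableT (mQL X)
  (mQL theta) mX (mY comonotone_rv) _ F_supp) => s t.
rewrite setTI; have /eqP := joint_law s t (mQ theta).
by rewrite eq_le => /andP[_]; exact.
Qed.

Lemma disutility_antimonotone : disutility antimonotone_rv =
  (\int[leb]_(p in `]0%R, 1%R[)
    (- utility F (Q X p + Q theta (1 - p))%R)%:E)%E.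
Proof.
apply/eqP; rewrite eq_le disutility_ge_antimonotone ?andbT; last first.
  exact: antimonotone_rv_law.
apply: (le_integral_utility (m1 := P) (m2 := leb) measurableT m01 mX
  (mY antimonotone_rv) (mQL X) mQaL _ F_supp) => s t.
rewrite setTI; have /eqP := joint_law s t mQa.
by rewrite eq_le => /andP[+ _]; exact.
Qed.

End coupling.

(** * Convex combinations in the extended reals *)

Section ereal_convex.
Local Open Scope ereal_scope.
Context (R : realType) (a : R) (x1 x2 y1 y2 : \bar R).
Hypotheses (a0 : (0 <= a)%R) (a1 : (a <= 1)%R).

Lemma le_convex_ereal : x2 <= x1 -> y2 <= y1 ->
  (1 - a)%:E * x2 + a%:E * y2 <= (1 - a)%:E * x1 + a%:E * y1.
Proof.
by move=> x21 y21; apply: leeD; apply: lee_wpmul2l; rewrite // lee_fin subr_ge0.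
Qed.

(** For [a] equal to 0 or 1 one term vanishes, even if infinite, and the other decides. For [a]
    strictly between, finiteness of the combination forces [x1] and [y1] to be finite, so both terms
    decrease strictly. *)
Lemma lt_convex_ereal : x1 <= 0 -> y1 <= 0 -> x2 <= 0 -> y2 <= 0 ->
  (-oo < x1 -> x2 < x1) -> (-oo < y1 -> y2 < y1) ->
  -oo < (1 - a)%:E * x1 + a%:E * y1 ->
  (1 - a)%:E * x2 + a%:E * y2 < (1 - a)%:E * x1 + a%:E * y1.
Proof.
move=> x10 y10 x20 y20 x21 y21.
move: a0; rewrite le_eqVlt => /orP[/eqP<-|a_gt0].
  by rewrite subr0 !mul1e !mul0e !adde0.
move: a1; rewrite le_eqVlt => /orP[/eqP->|a_lt1].
  by rewrite subrr !mul1e !mul0e !add0e.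
have b_gt0 : (0 < 1 - a)%R by rewrite subr_gt0.
case: x1 x10 x21 => [r1|//|] x10 x21; last first.
  by rewrite gt0_muleNy// ?lte_fin//.
case: y1 y10 y21 => [s1|//|] y10 y21; last first.
  by rewrite gt0_muleNy// ?lte_fin// addeNy.
move=> _; have {}x21 := x21 (ltNyr _); have {}y21 := y21 (ltNyr _).
case: x2 x20 x21 => [r2|//|] x20 x21; last first.
  by rewrite gt0_muleNy// ?lte_fin// addNye ltNyr.
case: y2 y20 y21 => [s2|//|] y20 y21; last first.
  by rewrite (gt0_muleNy (_ : 0 < a%:E))// ?lte_fin// addeNy ltNyr.
by rewrite -!EFinM -!EFinD lte_fin ltrD// ltr_pM2l// -lte_fin.
Qed.

End ereal_convex.

Section convex_integral.
Local Open Scope ereal_scope.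
Context (d : measure_display) (T : measurableType d) (R : realType).
Variables (mu : {measure set T -> \bar R}) (D : set T) (f g : T -> R) (a b : R).
Hypotheses (mD : measurable D) (mf : measurable_fun D f)
  (mg : measurable_fun D g).
Hypotheses (f0 : forall x, (0 <= f x)%R) (g0 : forall x, (0 <= g x)%R).
Hypotheses (a0 : (0 <= a)%R) (b0 : (0 <= b)%R).

(** Both integrands being nonnegative, the integrals can be infinite in one direction only and no
    indeterminate sum arises. *)
Lemma convex_oppe_integral :
  a%:E * - (\int[mu]_(x in D) (f x)%:E) +
  b%:E * - (\int[mu]_(x in D) (g x)%:E) =
  \int[mu]_(x in D) (- (a * f x + b * g x))%:E.
Proof.
have mkE (k : R) (h : T -> R) : measurable_fun D h ->
    measurable_fun D (fun x => k%:E * (h x)%:E).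
  by move=> mh; apply: measurable_funeM; exact/measurable_EFinP.
have ZE (k : R) (h : T -> R) : (0 <= k)%R -> measurable_fun D h ->
    (forall x, 0 <= h x)%R ->
    k%:E * (\int[mu]_(x in D) (h x)%:E) = \int[mu]_(x in D) (k%:E * (h x)%:E).
  move=> k0 mh h0; apply/esym; apply: ge0_integralZl; rewrite ?lee_fin//.
    exact/measurable_EFinP.
  by move=> x _; rewrite lee_fin.
have Z0 (k : R) (h : T -> R) : (0 <= k)%R -> (forall x, 0 <= h x)%R ->
    0 <= \int[mu]_(x in D) (k%:E * (h x)%:E).
  by move=> k0 h0; apply: integral_ge0 => x _; rewrite mule_ge0// lee_fin.
rewrite !muleN (ZE a f)// (ZE b g)// -oppeD; last first.
  by rewrite ge0_adde_def// inE Z0.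
rewrite -ge0_integralD//; first last.
- exact: mkE.
- by move=> x _; rewrite mule_ge0// lee_fin.
- exact: mkE.
- by move=> x _; rewrite mule_ge0// lee_fin.
rewrite -integral_ge0N; last first.
  by move=> x _; rewrite -!EFinM -EFinD lee_fin addr_ge0// mulr_ge0.
by apply: eq_integral => x _; rewrite -!EFinM -EFinD.
Qed.

End convex_integral.

(** * The objective: attained extrema, strict monotonicity, quantile formula *)

Section objective_theory.
Context (R : realType) (d : measure_display) (T : measurableType d).
Variables (P : probability T R) (theta : {RV P >-> R}) (Z : T -> R).
Hypothesis mZ : measurable_fun setT Z.
Hypothesis Z_atomless : forall z, P (Z @^-1` [set z]) = 0%E.
Variables (c : R) (F : cumulativeBounded (0 : R) c).
Hypothesis F_supp : compactly_supported_in_pos F.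
Hypothesis F_neq0 : exists x, F x != 0.
Variables (alpha : R).
Hypotheses (alpha_ge0 : 0 <= alpha) (alpha_le1 : alpha <= 1).

Let u := utility F.

Local Notation EU X Y := ('E_P[fun w => u (X w + Y w)%R])%E.

Let mU (X Y : {RV P >-> R}) : measurable_fun setT (fun w => - u (X w + Y w)).
Proof.
apply: measurable_funN; apply: measurableT_comp => //.
  exact: measurable_utility.
exact: measurable_funD.
Qed.

Let Nu_ge0 x : 0 <= - u x.
Proof. by rewrite oppr_ge0; exact: utility_le0. Qed.

Lemma expected_utilityE (X Y : T -> R) :
  (EU X Y = - \int[P]_w (- u (X w + Y w)%R)%:E)%E.
Proof.
rewrite unlock -integral_ge0N; last by move=> w _; rewrite lee_fin.
by apply: eq_integral => w _; rewrite -EFinN opprK.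
Qed.

Lemma expected_utility_le0 (X Y : T -> R) : (EU X Y <= 0)%E.
Proof.
rewrite expected_utilityE oppe_le0.
by apply: integral_ge0 => w _; rewrite lee_fin.
Qed.

Lemma le_expected_utility (X1 X2 Y : {RV P >-> R}) :
  {ae P, forall w, X2 w <= X1 w} -> (EU X2 Y <= EU X1 Y)%E.
Proof.
move=> X21; rewrite !expected_utilityE leeN2.
apply: ae_ge0_le_integral => //.
- by move=> w _; rewrite lee_fin.
- exact/measurable_EFinP.
- by move=> w _; rewrite lee_fin.
- exact/measurable_EFinP.
apply: filterS X21 => w X21 _; rewrite lee_fin lerN2.
by apply: utility_nondecreasing; rewrite ?lerD2r.
Qed.

Lemma lt_expected_utility (X1 X2 Y : {RV P >-> R}) :
  {ae P, forall w, X2 w <= X1 w} -> (0 < P [set w | (X2 w < X1 w)%R])%E ->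
  (-oo < EU X1 Y)%E -> (EU X2 Y < EU X1 Y)%E.
Proof.
move=> X21 PX21; rewrite !expected_utilityE lteN2 => EX1.
apply: lt_integral => //.
- by rewrite -lteN2/=.
- apply: filterS X21 => w X21 _; rewrite lerN2.
  by apply: utility_nondecreasing; rewrite ?lerD2r.
rewrite setTI; apply: (lt_le_trans PX21); apply: le_measure; rewrite ?inE.
- rewrite -[X in measurable X]setTI; exact: measurable_fun_ltr.
- rewrite -[X in measurable X]setTI; exact: measurable_fun_ltr.
by move=> w /= X21w; rewrite ltrN2; apply: utility_increasing; rewrite ?ltrD2r.
Qed.

Let Yc (X : {RV P >-> R}) := comonotone_rv X theta mZ.
Let Ya (X : {RV P >-> R}) := antimonotone_rv X theta mZ.

(** The comonotone copy maximizes the disutility among the competitors and is itself one of them. *)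
Lemma inf_expected_utilities (X : {RV P >-> R}) :
  ereal_inf (expected_utilities u theta X) = EU X (Yc X).
Proof.
apply/eqP; rewrite eq_le; apply/andP; split.
  apply: ereal_inf_lbound; exists (Yc X) => //.
  exact: comonotone_rv_law.
apply: le_ereal_inf_tmp => _ [Y YE <-].
rewrite (expected_utilityE X (Yc X)) (expected_utilityE X Y) leeN2.
apply: (le_trans (disutility_le_comonotone X F_supp YE)).
by rewrite -(disutility_comonotone X theta mZ Z_atomless F_supp).
Qed.

Lemma sup_expected_utilities (X : {RV P >-> R}) :
  ereal_sup (expected_utilities u theta X) = EU X (Ya X).
Proof.
apply/eqP; rewrite eq_le; apply/andP; split; last first.
  apply: ereal_sup_ubound; exists (Ya X) => //.
  exact: antimonotone_rv_law.
apply: ge_ereal_sup => _ [Y YE <-].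
rewrite (expected_utilityE X (Ya X)) (expected_utilityE X Y) leeN2.
apply: le_trans (disutility_ge_antimonotone X F_supp YE).
by rewrite -(disutility_antimonotone X theta mZ Z_atomless F_supp).
Qed.

Lemma objectiveE (X : {RV P >-> R}) : objective u theta alpha X =
  ((1 - alpha)%:E * EU X (Yc X) + alpha%:E * EU X (Ya X))%E.
Proof. by rewrite /objective inf_expected_utilities sup_expected_utilities. Qed.

Lemma le_objective (X1 X2 : {RV P >-> R}) :
  {ae P, forall w, X2 w <= X1 w} ->
  (objective u theta alpha X2 <= objective u theta alpha X1)%E.
Proof.
move=> X21; rewrite [leLHS]objectiveE [leRHS]objectiveE.
apply: le_convex_ereal; [exact: alpha_ge0|exact: alpha_le1| |].
  rewrite -[leLHS]inf_expected_utilities.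
  apply: le_trans (le_expected_utility _ X21); apply: ereal_inf_lbound.
  by exists (Yc X1) => //; exact: comonotone_rv_law.
rewrite -[leRHS]sup_expected_utilities.
apply: (le_trans (le_expected_utility _ X21)); apply: ereal_sup_ubound.
by exists (Ya X2) => //; exact: antimonotone_rv_law.
Qed.

(** For the infimum, the minimizer for [X1] competes in the problem for [X2]; for the supremum, the
    maximizer for [X2] competes in the problem for [X1]. Attainment keeps the inequalities
    strict. *)
Lemma lt_objective (X1 X2 : {RV P >-> R}) :
  {ae P, forall w, X2 w <= X1 w} -> (0 < P [set w | (X2 w < X1 w)%R])%E ->
  (-oo < objective u theta alpha X1)%E ->
  (objective u theta alpha X2 < objective u theta alpha X1)%E.
Proof.
move=> X21 PX21 J1oo; rewrite [ltLHS]objectiveE [ltRHS]objectiveE.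
apply: lt_convex_ereal; try exact: expected_utility_le0.
- exact: alpha_ge0.
- exact: alpha_le1.
- move=> X1oo; apply: le_lt_trans (lt_expected_utility X21 PX21 X1oo).
  rewrite -[leLHS]inf_expected_utilities; apply: ereal_inf_lbound.
  by exists (Yc X1) => //; exact: comonotone_rv_law.
- move=> X1oo.
  have YaE : (EU X1 (Ya X2) <= EU X1 (Ya X1))%E.
    rewrite -[leRHS]sup_expected_utilities; apply: ereal_sup_ubound.
    by exists (Ya X2) => //; exact: antimonotone_rv_law.
  (* If [X1] has expected utility [-oo] with the maximizer for [X2], then so does [X2], whereas the
     supremum for [X1] is finite. *)
  have [X1Ya|X1Ya] := ltP -oo%E (EU X1 (Ya X2)).
    exact: lt_le_trans (lt_expected_utility X21 PX21 X1Ya) YaE.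
  apply: (le_lt_trans (le_expected_utility (Ya X2) X21)).
  exact: (le_lt_trans X1Ya).
- by rewrite -[ltRHS]objectiveE.
Qed.

Lemma unit_quantileE (Y : {RV P >-> R}) (p : R) : 0 < p < 1 ->
  quantile Y p = unit_quantile Y p.
Proof.
move=> p01; rewrite /unit_quantile patchE mem_set/= ?in_itv//.
by case/andP: p01 => p0 p1; rewrite /quantile !leNgt p0 p1.
Qed.

(** The two copies turn the extrema into integrals over []0, 1[], which the weights recombine into
    one. *)
Lemma objective_quantileE (X : {RV P >-> R}) : objective u theta alpha X =
  (\int[lebesgue_measure]_(p in `]0%R, 1%R[)
     (quantile_utility u theta alpha (quantile X p) p)%:E)%E.
Proof.
pose f1 p : R := - u (unit_quantile X p + unit_quantile theta p).
pose f2 p : R := - u (unit_quantile X p + unit_quantile theta (1 - p)).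
have EYc : EU X (Yc X) =
    (- \int[lebesgue_measure]_(p in `]0%R, 1%R[) (f1 p)%:E)%E.
  rewrite expected_utilityE; congr (- _)%E.
  exact: (disutility_comonotone X theta mZ Z_atomless F_supp).
have EYa : EU X (Ya X) =
    (- \int[lebesgue_measure]_(p in `]0%R, 1%R[) (f2 p)%:E)%E.
  rewrite expected_utilityE; congr (- _)%E.
  exact: (disutility_antimonotone X theta mZ Z_atomless F_supp).
rewrite objectiveE [X in (_ * X + _)%E]EYc [X in (_ + _ * X)%E]EYa.
have mQ Y : measurable_fun setT (@unit_quantile _ _ _ P Y).
  exact: (@measurable_quantile_oo _ _ _ P Y).
have mf1 : measurable_fun setT f1.
  apply: measurable_funN; apply: measurableT_comp.
    exact: measurable_utility.
  exact: measurable_funD.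
have mf2 : measurable_fun setT f2.
  apply: measurable_funN; apply: measurableT_comp.
    exact: measurable_utility.
  apply: measurable_funD => //; apply: measurableT_comp => //.
  exact: measurable_funB.
have m01 : measurable (`]0, 1[%classic : set (measurableTypeR R)) by [].
have mf1' : measurable_fun (`]0, 1[%classic : set (measurableTypeR R)) f1.
  exact: (measurable_funTS mf1).
have mf2' : measurable_fun (`]0, 1[%classic : set (measurableTypeR R)) f2.
  exact: (measurable_funTS mf2).
have alpha0 : 0 <= 1 - alpha by rewrite subr_ge0.
have f10 p : 0 <= f1 p by exact: Nu_ge0.
have f20 p : 0 <= f2 p by exact: Nu_ge0.
transitivity (\int[lebesgue_measure]_(p in `]0%R, 1%R[)
    (- ((1 - alpha) * f1 p + alpha * f2 p))%:E)%E.
  exact: (convex_oppe_integral lebesgue_measure m01 mf1' mf2' f10 f20 alpha0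
    alpha_ge0).
apply: eq_integral => p; rewrite inE/= in_itv/= => p01.
have p01' : 0 < 1 - p < 1.
  by case/andP: p01 => p0 p1; rewrite subr_gt0 p1 ltrBlDr ltrDl.
rewrite /quantile_utility !unit_quantileE//.
have signs (k x y : R) : - ((1 - k) * - x + k * - y) = (1 - k) * x + k * y.
  by rewrite !mulrN opprD !opprK.
by congr EFin; exact: signs.
Qed.

End objective_theory.

(** * An atomless variable from the Brownian motion, and the conclusion *)

Lemma normal_prob_atomless (R : realType) (m s z : R) :
  normal_prob m s [set z] = 0%E.
Proof.
(* The normal law is absolutely continuous with respect to Lebesgue measure, for which points are
   null. *)
have /null_content_dominatesP dom := normal_prob_dominates m s.
by apply: dom => //; exact: lebesgue_measure_set1.
Qed.

Theorem lemma3p3 (R : realType) (d : measure_display) (T : measurableType d)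
    (P : probability T R) (complete_P : measure_is_complete P)
    (m : nat) (m_gt0 : (0 < m)%N)
    (W : R -> 'I_m -> {RV P >-> R}) (brownian_W : standard_brownian_motion W)
    (c : R) (F : cumulativeBounded (0 : R) c) (F_neq0 : exists x, F x != 0)
    (F_supp : compactly_supported_in_pos F)
    (theta : {RV P >-> R})
    (theta_lip : [lipschitz quantile theta p | p in `[0, 1]])
    (theta_diff : differentiable_in `[0, 1] (quantile theta))
    (alpha : R) (alpha_ge0 : 0 <= alpha) (alpha_le1 : alpha <= 1) :
  let u := utility F in
  let J := objective u theta alpha in
  let V := quantile_utility u theta alpha in
  [/\ forall X : {RV P >-> R},
        J X = (\int[lebesgue_measure]_(p in `]0%R, 1%R[)
                 (V (quantile X p) p)%:E)%E,
      forall X Y : {RV P >-> R}, same_law X Y -> J X = J Y,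
      forall X1 X2 : {RV P >-> R}, {ae P, forall w, (X2 w <= X1 w)%R} ->
        (0 < P [set w | (X2 w < X1 w)%R])%E ->
        (-oo < J X1)%E -> (J X2 < J X1)%E &
      forall (X : {RV P >-> R}) (e : R), 0 < e ->
        (-oo < J X)%E -> (J X < J (fun w => (X w + e)%R))%E].
Proof.
move=> u J V.
(* The increment of one coordinate over a unit of time is normal, hence atomless; its dependence on
   [X] is immaterial. *)
pose Z : T -> R := W 1 (Ordinal m_gt0) \- W 0 (Ordinal m_gt0).
have mZ : measurable_fun setT Z by apply: measurable_funB.
have Z_atomless z : P (Z @^-1` [set z]) = 0%E.
  have [_ Wnormal _ _] := brownian_W.
  by rewrite Wnormal ?lexx// normal_prob_atomless.
have JE := objective_quantileE theta mZ Z_atomless F_supp F_neq0 alpha_ge0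
  alpha_le1.
split.
- exact: JE.
- move=> X Y XY; rewrite /J !JE; apply: eq_integral => p.
  rewrite inE/= in_itv/= => /andP[p0 p1].
  suff -> : quantile X p = quantile Y p by [].
  (* Inside []0, 1[] the quantile is read off the distribution function, which equality in law
     preserves. *)
  rewrite /quantile !leNgt p0 p1 /= /quantile_oo; congr inf.
  by apply/funext => z; rewrite /= /cdf XY.
- move=> X1 X2 X21 PX21.
  exact: (lt_objective mZ Z_atomless F_supp F_neq0 alpha_ge0 alpha_le1 X21
    PX21).
- move=> X e e0 JX.
  have mXe : measurable_fun setT (fun w => X w + e) by exact: measurable_funD.
  pose Xe : {RV P >-> R} := mfun_Sub (mem_set mXe).
  have XXe : {ae P, forall w, X w <= Xe w}.
    by apply: aeW => w; rewrite /= lerDl ltW.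
  apply: (lt_objective (X1 := Xe) mZ Z_atomless F_supp F_neq0 alpha_ge0
    alpha_le1 XXe).
    rewrite (_ : [set w | _] = setT) ?probability_setT//.
    by rewrite -subTset => w _ /=; rewrite ltrDl.
  (* The strict comparison needs [J Xe] above [-oo], which follows from [J X] by weak
     monotonicity. *)
  apply: (lt_le_trans JX).
  exact: (le_objective theta mZ Z_atomless F_supp F_neq0 alpha_ge0 alpha_le1
    XXe).
Qed.
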